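(* Let $r\ge 2$ and $n\ge 1$, and let $G=K_{n,n,\dots,n}$ be the complete $r$-partite graph with $r$ parts of size $n$. Let $\mathcal{E}$ be the set of $r$-element subsets of $V(G)$ containing exactly one vertex from each part (so $|\mathcal{E}|=n^r$). Choose elements of $\mathcal{E}$ one at a time in a uniformly random order (without repetition), stopping as soon as every vertex of $G$ lies in at least one chosen element; let $G_\omega$ be the resulting $r$-uniform hypergraph on $V(G)$. Then the expected number of matchings in $G_\omega$ is $$(n!)^{r-1}\sum_{i=1}^r (-1)^{i-1}\frac{\binom{r}{i}}{\binom{n^r-(n-1)^i n^{r-i}+n-1}{n}}.$$
   Context: A matching in an $r$-uniform hypergraph on vertex set $V$ is a set $M$ of its edges such that every vertex of $V$ lies in exactly one edge of $M$. *)

(* Defs.v *)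
From mathcomp Require Import all_boot all_order all_algebra.
Set Implicit Arguments. Unset Strict Implicit. Unset Printing Implicit Defensive.
Import Order.TTheory GRing.Theory Num.Theory.

(* Vertices of K_{n,...,n} (r parts of size n): pairs (part, index). *)
Notation vert r n := (prod (ordinal r) (ordinal n)).

Definition part (r n : nat) (i : 'I_r) : {set vert r n} :=
  [set v : vert r n | v.1 == i].

Definition transversals (r n : nat) : {set {set vert r n}} :=
  [set e : {set vert r n} | [forall i : 'I_r, #|e :&: part n i| == 1]].

Definition covers (r n : nat) (s : seq {set vert r n}) : bool :=
  [forall v : vert r n, has (fun e : {set vert r n} => v \in e) s].

Definition stop_time (r n : nat) (s : seq {set vert r n}) : nat :=
  find (fun k => covers (take k s)) (iota 0 (size s).+1).

Definition G_omega (r n : nat) (s : seq {set vert r n}) : {set {set vert r n}} :=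
  [set e in take (stop_time s) s].

(* A matching (perfect matching) of the hypergraph with edge set H:
   a set M of edges of H such that every vertex lies in exactly one edge of M. *)
Definition is_matching (r n : nat) (H M : {set {set vert r n}}) : bool :=
  (M \subset H) && [forall v : vert r n, #|[set e in M | v \in e]| == 1].

Definition num_matchings (r n : nat) (H : {set {set vert r n}}) : nat :=
  #|[set M : {set {set vert r n}} | is_matching H M]|.

Definition orderings (r n : nat) : seq (seq {set vert r n}) :=
  permutations (enum (transversals r n)).

Definition expected_matchings (r n : nat) : rat :=
  (\sum_(s <- orderings r n) (num_matchings (G_omega s))%:R)
    / (size (orderings r n))%:R.

(* Main.v *)
Require Import Defs.
From mathcomp Require Import all_boot all_order all_fingroup all_algebra.
From mathcomp Require Import zify ring.
Set Implicit Arguments. Unset Strict Implicit. Unset Printing Implicit Defensive.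
Import Order.TTheory GRing.Theory Num.Theory.

(* Edges are functions f : 'I_r -> 'I_n, and there are (n!)^(r-1) perfect
   matchings N of the complete r-partite hypergraph.  By linearity it suffices
   to find the probability that a fixed N is contained in G_omega.  This happens
   iff the last edge f of N to be drawn precedes all other edges through some
   vertex of f.  For fixed f, inclusion-exclusion over the set S of such
   vertices reduces this to the event that f comes after the n - 1 other edges
   of N and before the h - 1 other edges meeting f in S, where
   h = n^r - (n-1)^|S| n^(r-|S|).  These edges being distinct, that event has
   probability (n-1)! (h-1)! / (n+h-1)! = 1 / (n 'C(h+n-1, n)), and summing over
   the n choices of f cancels the factor 1/n. *)

(** * Relative order of given elements in a uniformly random ordering *)

Section Between.
Variable T : eqType.
Implicit Types (B C s t : seq T) (e x : T).

Definition between B e C s :=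
  all (fun x => index x s < index e s) B && all (fun x => index e s < index x s) C.

(** Conditioning on the first element drawn; this is the recursion behind [count_between]. *)
Lemma count_permutations_cons t (P : pred (seq T)) : uniq t -> 0 < size t ->
  count P (permutations t) =
  \sum_(x <- t) count (fun s => P (x :: s)) (permutations (rem x t)).
Proof.
move=> Ut t_gt0; rewrite (seq.permP (permutationsE t_gt0)) undup_id //.
rewrite count_flatten sumnE -map_comp big_map; apply: eq_bigr => x _ /=.
by rewrite count_map.
Qed.

Lemma index_head_neq x y s : y != x -> index y (x :: s) = (index y s).+1.
Proof. by rewrite eq_sym /= => /negPf->. Qed.

(** This lemma and the next three settle the effect of the first draw, which is [e], an irrelevant
    element, an element of [B] or an element of [C]. *)
Lemma between_head B e C s : e \notin C -> between B e C (e :: s) = nilp B.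
Proof.
move=> eC; rewrite /between /= eqxx.
have -> : all (fun x => 0 < (if e == x then 0 else (index x s).+1)) C.
  by apply/allP => x xC; case: eqP xC eC => // -> ->.
by case: B => //= x B; rewrite ltn0.
Qed.

Lemma between_cons x B e C s : x != e -> x \notin B -> x \notin C ->
  between B e C (x :: s) = between B e C s.
Proof.
move=> xe xB xC; rewrite /between index_head_neq 1?eq_sym //.
congr (_ && _); apply: eq_in_all => y yin; rewrite index_head_neq //.
  by apply: contraNneq xB => <-.
by apply: contraNneq xC => <-.
Qed.

Lemma between_cons_before x B e C s : x != e -> uniq B -> x \in B -> x \notin C ->
  between B e C (x :: s) = between (rem x B) e C s.
Proof.
move=> xe UB xB xC; rewrite -(between_cons s xe _ xC) ?mem_rem_uniqF //.
rewrite /between (perm_all _ (perm_to_rem xB)) (index_head_neq s (y := e)) 1?eq_sym //.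
by rewrite /= eqxx.
Qed.

Lemma between_cons_after x B e C s : x != e -> x \in C ->
  between B e C (x :: s) = false.
Proof.
move=> xe xC; rewrite /between index_head_neq 1?eq_sym // andbC.
by case: allP => // /(_ x xC); rewrite /= eqxx.
Qed.

(* In a uniformly random ordering only the relative order of [B ++ e :: C]
   matters, and [b! c!] of its [(b + c + 1)!] orders are favourable. *)
Lemma count_between t B e C :
  uniq t -> uniq (B ++ e :: C) -> {subset B ++ e :: C <= t} ->
  count (between B e C) (permutations t) * (size B + size C).+1`! =
  (size B)`! * (size C)`! * (size t)`!.
Proof.
(* Only [t] and [B] vary in the induction: drawing an element of [B] or an irrelevant one leaves a
   smaller instance, while drawing [e] or an element of [C] decides the event. *)
elim: {t}(size t) {-2}t (erefl (size t)) B => [|m IHm] t szt B Ut Ubec sub.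
  by move/size0nil: szt sub => -> /(_ e); rewrite mem_cat mem_head orbT => /(_ isT).
have [UB eB eC] : [/\ uniq B, e \notin B & e \notin C].
  by move: Ubec; rewrite cat_uniq /= negb_or => /and3P[-> /andP[-> _] /andP[->]].
have BC x : x \in B -> x \notin C.
  move: Ubec; rewrite cat_uniq => /and3P[_ /hasPn h _] xB.
  by apply/negP => xC; move: (h x); rewrite inE xC orbT /= xB => /(_ isT).
pose R := [seq x <- t | x \notin B ++ e :: C].
have Dt : perm_eq t ((B ++ e :: C) ++ R).
  rewrite -(perm_filterC (mem (B ++ e :: C)) t) perm_cat2r.
  apply: uniq_perm => //; first exact: filter_uniq.
  by move=> x; rewrite mem_filter /=; case: (boolP (x \in B ++ e :: C)) => // /sub ->.
have szR : m.+1 = size B + (size C).+1 + size R.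
  by rewrite -szt (perm_size Dt) !size_cat.
rewrite count_permutations_cons ?szt // (perm_big _ Dt) /= !big_cat /= big_cons.
have rem_t x : x \in t -> size (rem x t) = m by move=> xt; rewrite size_rem ?szt.
have -> : \sum_(x <- C) count (fun s => between B e C (x :: s))
            (permutations (rem x t)) = 0.
  rewrite big_seq big1 // => x xC; apply/eqP; rewrite -leqn0 leqNgt -has_count.
  apply/hasPn => s _; rewrite between_cons_after //.
  by apply: contraNneq eC => <-.
have -> : count (fun s => between B e C (e :: s)) (permutations (rem e t)) =
          nilp B * m`!.
  rewrite (eq_count (a2 := fun=> nilp B)); last by move=> s; rewrite between_head.
  case: (nilp B); last by rewrite count_pred0.
  by rewrite count_predT size_permutations ?rem_uniq // rem_t ?mul1n //
             sub // mem_cat mem_head orbT.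
rewrite addn0 !mulnDl.
have -> : (\sum_(x <- R) count (fun s => between B e C (x :: s))
            (permutations (rem x t))) * (size B + size C).+1`! =
          size R * ((size B)`! * (size C)`! * m`!).
  rewrite big_distrl /= big_seq.
  rewrite (eq_bigr (fun=> (size B)`! * (size C)`! * m`!)).
    by rewrite -big_seq big_const_seq count_predT iter_addn_0 mulnC.
  move=> x; rewrite mem_filter mem_cat inE !negb_or => /andP[/and3P[xB xe xC] xt].
  rewrite (eq_count (a2 := between B e C)); last by move=> s; rewrite between_cons.
  rewrite -(rem_t x xt) IHm ?rem_t ?rem_uniq // => y yin.
  rewrite mem_rem_uniq // inE sub // andbT; apply: contraTneq yin => ->.
  by rewrite mem_cat inE !negb_or xB xe xC.
(* The induction hypothesis for [rem x B] comes with the factorial of [size B + size C]; passing to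
   that of its successor leaves the extra factor. *)
have -> : (\sum_(x <- B) count (fun s => between B e C (x :: s))
            (permutations (rem x t))) * (size B + size C).+1`! =
          size B * ((size B).-1`! * (size C)`! * m`! * (size B + size C).+1).
  rewrite big_distrl /= big_seq.
  rewrite (eq_bigr (fun=> (size B).-1`! * (size C)`! * m`! * (size B + size C).+1)).
    by rewrite -big_seq big_const_seq count_predT iter_addn_0 mulnC.
  move=> x xB; have xe : x != e by apply: contraNneq eB => <-.
  have xt : x \in t by rewrite sub // mem_cat xB.
  rewrite (eq_count (a2 := between (rem x B) e C)); last first.
    by move=> s; rewrite between_cons_before // BC.
  have B_gt0 : 0 < size B by case: (B) xB.
  have Ur : uniq (rem x B ++ e :: C).
    by apply: subseq_uniq Ubec; rewrite cat_subseq ?rem_subseq.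
  rewrite factS mulnCA mulnC; congr (_ * _).
  have := IHm (rem x t) (rem_t x xt) (rem x B).
  rewrite size_rem // rem_t // -addSn prednK // => -> //; first exact: rem_uniq.
  move=> y yin; rewrite mem_rem_uniq // inE sub ?andbT; last first.
    by move: yin; rewrite !mem_cat => /orP[/mem_rem->|->]; rewrite ?orbT.
  apply: contraTneq yin => ->.
  by rewrite mem_cat inE !negb_or mem_rem_uniqF // xe BC.
(* Up to the common factor b! c! m!, the draws from [R] weigh [size R] and the remaining ones b + c
   + 1, the latter coming from [e] alone if [B] is empty and from [B] alone otherwise. Together they
   give [m.+1]. *)
rewrite (factS m) szR; case: (B) => [|b0 B'] /=.
  by rewrite /nilp /= fact0 !add0n (factS (size C)); ring.
by rewrite /nilp /= !factS; ring.
Qed.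

End Between.

(** * Transversals as functions, and the number of perfect matchings *)

Lemma card_family_prod (aT rT : finType) (F : aT -> pred rT) :
  #|(family F : simpl_pred {ffun aT -> rT})| = \prod_i #|F i|.
Proof. by rewrite card_family foldrE big_map enumT. Qed.

Section Transversals.
Variables r n : nat.
Implicit Types (f g : {ffun 'I_r -> 'I_n}) (N : {set {ffun 'I_r -> 'I_n}}).

Definition edge f : {set vert r n} := [set v | f v.1 == v.2].

Lemma edge_inj : injective edge.
Proof.
move=> f g /setP fg; apply/ffunP => i.
by have := fg (i, f i); rewrite !inE /= eqxx => /esym/eqP->.
Qed.

(** A transversal is the graph of the function that picks its unique vertex in each part. *)
Lemma transversalsE : transversals r n = edge @: [set: {ffun 'I_r -> 'I_n}].
Proof.
apply/setP => e; apply/idP/imsetP.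
  rewrite inE => /forallP/= h.
  have /fin_all_exists[F hF] i : exists j, e :&: part n i = [set (i, j)].
    have /cards1P[[i' j] De] := h i; exists j; rewrite De.
    suff -> : i = i' by [].
    by have := set11 (i', j); rewrite -De !inE => /andP[_ /eqP].
  exists (finfun F); first by rewrite inE.
  apply/setP => -[i j]; rewrite inE ffunE /=.
  move/setP: (hF i) => /(_ (i, j)); rewrite !inE eqxx andbT => ->.
  by rewrite xpair_eqE eqxx eq_sym.
case=> f _ ->; rewrite inE; apply/forallP => i; apply/cards1P.
exists (i, f i); apply/setP => -[i' j]; rewrite !inE xpair_eqE /=.
by case: (i' =P i) => [->|]; rewrite ?andbT ?andbF // eq_sym.
Qed.

Lemma mem_transversals f : edge f \in transversals r n.
Proof. by rewrite transversalsE imset_f. Qed.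

Definition perfect N :=
  [forall v : vert r n, #|[set f in N | f v.1 == v.2]| == 1].

(** The range of summation no longer depends on [H], which is what linearity of expectation
    requires. *)
Lemma num_matchingsE (H : {set {set vert r n}}) : H \subset transversals r n ->
  num_matchings H = \sum_(N | perfect N) (edge @: N \subset H).
Proof.
move=> sH; rewrite -big_mkcondr sum1_card -(card_imset _ (imset_inj edge_inj)).
apply: eq_card => M; rewrite inE; apply/andP/imsetP; last first.
  case=> N /andP[/forallP pN sN] ->; split=> //; apply/forallP => v.
  rewrite -(eqP (pN v)) -(card_imset _ edge_inj); apply/eqP; apply: eq_card => e.
  rewrite inE; apply/andP/imsetP => [[/imsetP[f fN ->]]|[f]]; rewrite inE.
    by move=> fv; exists f; rewrite // inE fN.
  by case/andP=> fN fv ->; rewrite imset_f // inE.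
case=> sM /forallP pM.
have DM : M = edge @: [set f | edge f \in M].
  apply/setP => e; apply/idP/imsetP => [eM|[f]]; last by rewrite inE => ? ->.
  have := subsetP sH e (subsetP sM e eM).
  by rewrite transversalsE => /imsetP[f _ De]; exists f; rewrite // inE -De.
exists [set f | edge f \in M] => //; rewrite unfold_in -DM sM andbT.
apply/forallP => v; rewrite -(eqP (pM v)) -(card_imset _ edge_inj).
apply/eqP; apply: eq_card => e; rewrite inE; apply/imsetP/andP.
  by case=> f; rewrite !inE => /andP[fM fv] ->; rewrite inE.
rewrite {1}DM => -[/imsetP[f fM ->]]; rewrite inE => fv.
by exists f; rewrite // inE fM.
Qed.

Lemma perfect_cover N i j : perfect N -> exists2 f, f \in N & f i = j.
Proof.
move/forallP/(_ (i, j))/cards1P=> [f Df]; have := set11 f.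
by rewrite -Df inE => /andP[fN /eqP fij]; exists f.
Qed.

Lemma perfect_inj N f g i : perfect N -> f \in N -> g \in N -> f i = g i -> f = g.
Proof.
move/forallP/(_ (i, g i))/cards1P=> [h Dh] fN gN fgi.
have: f \in [set h] by rewrite -Dh inE fN fgi /=.
have: g \in [set h] by rewrite -Dh inE gN /=.
by rewrite !inE => /eqP-> /eqP.
Qed.

Lemma card_perfect_set N (i0 : 'I_r) : perfect N -> #|N| = n.
Proof.
move=> pN; have inj : {in N &, injective (fun f => f i0)}.
  by move=> f g fN gN /(perfect_inj pN fN gN).
rewrite -(card_in_imset inj) -[RHS]card_ord; apply: eq_card => j; rewrite inE.
by apply/imsetP; have [f fN <-] := perfect_cover i0 j pN; exists f.
Qed.

Definition perms_set (s : {ffun 'I_r -> {perm 'I_n}}) :=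
  [set [ffun i => s i j] | j : 'I_n].

(** Labelling the members of a perfect set by their vertex in part [i0] turns every other part into
    a permutation of the labels. Requiring the identity at [i0] makes this encoding unique and
    leaves r - 1 free permutations. *)
Lemma card_perfect (i0 : 'I_r) : #|[set N | perfect N]| = n`! ^ r.-1.
Proof.
pose F i : pred {perm 'I_n} := if i == i0 then pred1 (1%g : {perm 'I_n}) else predT.
have <- : #|(family F : simpl_pred {ffun 'I_r -> {perm 'I_n}})| = n`! ^ r.-1.
  rewrite card_family_prod (bigD1 i0) //= /F eqxx card1 mul1n.
  rewrite (eq_bigr (fun=> n`!)); last first.
    move=> i /negPf->; rewrite -[n in RHS]card_ord -[in RHS]cardsT -card_perm.
    by apply: eq_card => s; rewrite !inE; apply/esym/subsetP => x; rewrite inE.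
  by rewrite prod_nat_const cardC1 card_ord.
have F0 s : s \in family F -> s i0 = 1%g.
  by move/familyP/(_ i0); rewrite /F eqxx => /eqP.
have inj_s : {in family F &, injective perms_set}.
  move=> s t sF tF Est; apply/ffunP => i; apply/permP => j.
  have: [ffun i => s i j] \in perms_set t by rewrite -Est imset_f.
  case/imsetP=> k _ /ffunP E; have := E i; have := E i0; rewrite !ffunE.
  by rewrite !F0 // !perm1 => ->.
rewrite -(card_in_imset inj_s); apply: eq_card => N; rewrite inE.
apply/idP/imsetP => [pN|[s sF ->]]; last first.
  (* The member through [(i, j)] is the one whose label is the preimage of [j] under [s i]. *)
  apply/forallP => -[i j]; apply/cards1P; exists [ffun k => s k ((s i)^-1 j)%g].
  apply/setP => f; rewrite !inE; apply/andP/eqP => [[/imsetP[k _ ->]]|->].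
    by rewrite ffunE /= => /eqP <-; rewrite permK.
  by rewrite ffunE /= permKV eqxx; split=> //; apply: imset_f.
(* [c j] is the member through vertex [j] of part [i0]. Distinct members share no vertex, so each
   coordinate of [c] is a permutation. *)
have /fin_all_exists2[c cN c0] j : exists2 f, f \in N & f i0 = j by apply: perfect_cover.
have c_inj i : injective (fun j => c j i).
  by move=> j k /(perfect_inj pN (cN j) (cN k)) Ejk; rewrite -(c0 j) -(c0 k) Ejk.
exists [ffun i => perm (@c_inj i)].
  apply/familyP => i; rewrite ffunE /F; case: eqP => // ->.
  by apply/eqP/permP => j; rewrite permE perm1.
apply/setP => f; apply/idP/imsetP => [fN|[j _ ->]].
  exists (f i0) => //; apply: (perfect_inj (i := i0) pN) => //.
    rewrite (_ : finfun _ = c (f i0)) //.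
    by apply/ffunP => i; rewrite !ffunE permE.
  by rewrite !ffunE permE c0.
by rewrite (_ : finfun _ = c j) //; apply/ffunP => i; rewrite !ffunE permE.
Qed.

Definition hit f (S : {set 'I_r}) :=
  [set g : {ffun 'I_r -> 'I_n} | [exists i in S, g i == f i]].

(** The complement is a product: avoiding [f i] leaves n - 1 values for each [i] in [S], and all n
    values remain elsewhere. *)
Lemma card_hit f S : #|hit f S| = n ^ r - n.-1 ^ #|S| * n ^ (r - #|S|).
Proof.
pose F i : pred 'I_n := if i \in S then predC1 (f i) else predT.
have := cardsC (hit f S); rewrite card_ffun !card_ord => <-.
suff -> : #|~: hit f S| = n.-1 ^ #|S| * n ^ (r - #|S|) by rewrite addnK.
transitivity #|(family F : simpl_pred {ffun 'I_r -> 'I_n})|.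
  apply: eq_card => g; rewrite !inE negb_exists; apply: eq_forallb => i.
  rewrite [RHS]unfold_in negb_and /= /F; case: (i \in S).
by []. by [].
rewrite card_family_prod (bigID (mem S)) /=; congr (_ * _).
  rewrite (eq_bigr (fun=> n.-1)) ?prod_nat_const // => i iS.
  by rewrite /F iS cardC1 card_ord.
rewrite (eq_bigr (fun=> n)) => [|i /negPf iS]; last by rewrite /F iS card_ord.
rewrite prod_nat_const; congr (_ ^ _).
by have := cardC (mem S); rewrite card_ord => /esym rE; rewrite [X in X - _]rE addKn.
Qed.

End Transversals.

Arguments edge {r n} f.

(** * The stopping time and the last drawn edge of a matching *)

Section Stopping.
Variables r n : nat.
Implicit Types (f g : {ffun 'I_r -> 'I_n}) (N : {set {ffun 'I_r -> 'I_n}}).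

Lemma covers_transversals s :
  s \in orderings r n -> covers s.
Proof.
rewrite mem_permutations => /perm_mem ms; apply/forallP => -[i j].
apply/hasP; exists (edge [ffun=> j]); last by rewrite inE ffunE.
by rewrite ms mem_enum mem_transversals.
Qed.

(** The search in [stop_time] succeeds because its range includes [size s], where the prefix is the
    whole ordering. *)
Lemma covers_stop_time s : s \in orderings r n -> covers (take (stop_time s) s).
Proof.
move=> /covers_transversals cs.
have hs : has (fun k => covers (take k s)) (iota 0 (size s).+1).
  by apply/hasP; exists (size s); rewrite ?mem_iota ?take_size /=.
have := nth_find 0 hs; rewrite nth_iota ?add0n //.
by move: hs; rewrite has_find size_iota.
Qed.

Lemma covers_before k (s : seq {set vert r n}) : k < stop_time s -> ~~ covers (take k s).
Proof.
move=> lt_k; have := before_find 0 lt_k; rewrite nth_iota ?add0n => [->//|].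
by apply: leq_trans lt_k _; rewrite -[X in _ <= X](size_iota 0); apply: find_size.
Qed.

Lemma G_omega_sub s : s \in orderings r n -> G_omega s \subset transversals r n.
Proof.
rewrite mem_permutations => /perm_mem ms; apply/subsetP => e; rewrite inE.
by move/mem_take; rewrite ms mem_enum.
Qed.

(** Serves both for a matching and for a set [hit f S] in the role of [N]. *)
Definition others N f := [seq edge g | g <- enum (N :\ f)].

Lemma all_others (P : pred {set vert r n}) N f :
  reflect (forall g, g \in N -> g != f -> P (edge g)) (all P (others N f)).
Proof.
rewrite all_map; apply: (iffP allP) => h g.
  by move=> gN gf; apply: h; rewrite mem_enum !inE gf.
by rewrite mem_enum !inE => /andP[? ?]; apply: h.
Qed.

(* At the stopping time all of [edge @: N] is present iff its last edge [f]
   was not drawn too late, i.e. iff some vertex of [f] was still uncovered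
   just before [f] was drawn. *)
Lemma edges_sub_G_omega s N (i0 : 'I_r) (j0 : 'I_n) :
  s \in orderings r n -> perfect N ->
  (edge @: N \subset G_omega s) =
  [exists f in N, [exists i,
     between (others N f) (edge f) (others (hit f [set i]) f) s]].
Proof.
move=> sO pN.
have ins f : edge f \in s.
  move: sO; rewrite mem_permutations => /perm_mem->.
  by rewrite mem_enum mem_transversals.
have inG f : (edge f \in G_omega s) = (index (edge f) s < stop_time s).
  by rewrite inE (in_take _ (ins f)).
have idx_inj f g : index (edge f) s = index (edge g) s -> f = g.
  by move=> E; apply: edge_inj; rewrite -(nth_index set0 (ins f)) E nth_index.
apply/subsetP/exists_inP => [sub|[f fN /existsP[i /andP[]]]].
  have [f0 f0N _] := perfect_cover i0 j0 pN.
  (* The witness [f] is the member of [N] drawn last. *)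
  case: (arg_maxnP (fun f => index (edge f) s) f0N) => f fN fmax0.
  have fmax g : g \in N -> index (edge g) s <= index (edge f) s by apply: fmax0.
  exists f => //.
  have ltT : index (edge f) s < stop_time s by rewrite -inG sub // imset_f.
  (* Some vertex [(i, j)] is still uncovered just before [f] is drawn, so no edge through it
     precedes [f]. The member of [N] through it is then [f] itself, by maximality. *)
  have /forallPn[[i j] /hasPn nc] := covers_before ltT.
  have late g : g i = j -> index (edge f) s <= index (edge g) s.
    move=> gij; rewrite leqNgt -(in_take _ (ins g)); apply/negP => /nc.
    by rewrite inE /= gij eqxx.
  have [g gN gij] := perfect_cover i j pN.
  have fg : f = g.
    by apply: idx_inj; apply/eqP; rewrite eqn_leq late //= fmax.
  apply/existsP; exists i; apply/andP; split; apply/all_others => h.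
    move=> hN hf; rewrite ltn_neqAle fmax // andbT.
    by apply: contraNneq hf => /idx_inj ->.
  rewrite inE => /exists_inP[i']; rewrite inE => /eqP-> /eqP hi hf.
  rewrite ltn_neqAle late ?hi ?fg // andbT.
  by apply: contraNneq hf => /idx_inj <-; rewrite fg.
move=> /all_others before /all_others after.
have max_f g : g \in N -> index (edge g) s <= index (edge f) s.
  by move=> gN; have [-> //|gf] := eqVneq g f; rewrite ltnW // before.
move=> _ /imsetP[g gN ->]; rewrite inG; apply: leq_ltn_trans (max_f g gN) _.
(* If the process stopped before [f], an edge [h] drawn earlier would already cover [(i, f i)],
   against [after]. *)
rewrite ltnNge; apply/negP => leT.
have /forallP/(_ (i, f i))/hasP[e eT] := covers_stop_time sO.
have : e \in transversals r n.
  by move: sO (mem_take eT); rewrite mem_permutations => /perm_mem->; rewrite mem_enum.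
rewrite transversalsE => /imsetP[h _ De]; rewrite {e}De in eT *.
rewrite inE /= => /eqP hi.
have ltT : index (edge h) s < stop_time s by rewrite -(in_take _ (ins h)).
have := leq_trans ltT leT; have [->|hf] := eqVneq h f; first by rewrite ltnn.
rewrite ltnNge ltnW // after // inE; apply/exists_inP; exists i; rewrite ?set11 //.
by rewrite hi.
Qed.

(** Both [f] and [g] would be the last member of [N]; hence the events for distinct [f] are
    disjoint. *)
Lemma between_last_unique s N f g C D :
  f \in N -> g \in N ->
  between (others N f) (edge f) C s -> between (others N g) (edge g) D s -> f = g.
Proof.
move=> fN gN /andP[/all_others hf _] /andP[/all_others hg _].
have [//|fg] := eqVneq f g.
have := hf g gN; rewrite eq_sym => /(_ fg) lt1.
by have := ltn_trans lt1 (hg f fN fg); rewrite ltnn.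
Qed.

(** [hit f S] is the union of the sets [hit f [set i]] over [i] in [S], so the intersections in
    inclusion-exclusion are again [between] events. An empty [S] would lose the condition that [f]
    is last in [N]. *)
Lemma between_hit s N f (S : {set 'I_r}) : S != set0 ->
  between (others N f) (edge f) (others (hit f S) f) s =
  [forall i in S, between (others N f) (edge f) (others (hit f [set i]) f) s].
Proof.
case/set0Pn=> i0 i0S; apply/andP/forall_inP => [[before /all_others after] i iS|h].
  apply/andP; split; first exact: before.
  apply/all_others => g; rewrite inE => /exists_inP[k].
  rewrite inE => /eqP-> gi; apply: after; rewrite inE; apply/exists_inP.
  by exists i.
split; first by case/andP: (h i0 i0S).
apply/all_others => g; rewrite inE => /exists_inP[i iS gi].
have /andP[_ /all_others] := h i iS; apply; rewrite inE; apply/exists_inP.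
by exists i; rewrite ?set11.
Qed.

End Stopping.

(** * Inclusion-exclusion, probabilities and the expectation *)

Local Open Scope ring_scope.

(** The indicator that no [b i] holds is the product of the factors 1 - [b i]. Expanded over
    subsets, its empty term is the 1 that cancels on complementing. *)
Lemma inclusion_exclusion_exists (R : comNzRingType) (I : finType) (b : pred I) :
  [exists i, b i]%:R =
  \sum_(S : {set I} | S != set0) (-1) ^+ #|S|.-1 * [forall i in S, b i]%:R :> R.
Proof.
have E : (~~ [exists i, b i])%:R = \prod_i (- (b i)%:R + 1) :> R.
  case: existsP => [[i bi]|nb].
    by rewrite (bigD1 i) //= bi addNr mul0r.
  rewrite big1 // => i _; case: (boolP (b i)) => [bi|]; last by rewrite oppr0 add0r.
  by case: nb; exists i.
have prodE (S : {set I}) : \prod_i (if i \in S then - (b i)%:R else 1) =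
    (-1) ^+ #|S| * [forall i in S, b i]%:R :> R.
  rewrite -big_mkcond /= prodrN; congr (_ * _).
  case: forall_inP => [bS|/forall_inP/forall_inPn[i iS /negPf bi]].
    by rewrite big1 // => i /bS ->.
  by rewrite (bigD1 i) //= bi mul0r.
move: E; rewrite bigA_distr (bigD1 set0) //= prodE cards0 mul1r.
have -> : [forall i in set0, b i] by apply/forall_inP => i; rewrite inE.
move=> E; have -> : [exists i, b i]%:R = 1 - (~~ [exists i, b i])%:R :> R.
  by case: [exists i, b i] => /=; rewrite ?subr0 ?subrr.
rewrite E opprD addrA subrr add0r -sumrN; apply: eq_bigr => S S0.
rewrite prodE -mulNr; congr (_ * _).
by rewrite -[in LHS](prednK (n := #|S|)) ?card_gt0 // exprS mulN1r opprK.
Qed.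

Lemma sum_card_nonempty (R : pzSemiRingType) (I : finType) (F : nat -> R) :
  \sum_(S : {set I} | S != set0) F #|S| =
  \sum_(1 <= i < #|I|.+1) 'C(#|I|, i)%:R * F i.
Proof.
have card_lt (S : {set I}) : (#|S| < #|I|.+1)%N by rewrite ltnS max_card.
rewrite big_geq_mkord.
rewrite (partition_big (fun S => Ordinal (card_lt S)) (fun i => 1 <= i)%N) /=; last first.
  by move=> S; rewrite card_gt0.
apply: eq_bigr => i i_gt0; rewrite (eq_bigr (fun=> F i)); last first.
  by move=> S /andP[_ /eqP <-].
rewrite big_const iter_addr_0 mulr_natl -card_draws; congr (_ *+ _).
apply: eq_card => S; rewrite inE unfold_in.
rewrite (_ : (Ordinal _ == i) = (#|S| == i)) //.
by case: (#|S| =P i) => [Ei|]; rewrite ?andbF // -card_gt0 Ei i_gt0.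
Qed.

(** The left side is the favourable fraction from [count_between] with n - 1 elements before and c
    after. *)
Lemma ratio_binomial n c : (0 < n)%N ->
  (n.-1`! * c`!)%:R / (n.-1 + c).+1`!%:R = n%:R^-1 / 'C(n + c, n)%:R :> rat.
Proof.
move=> n_gt0; have := bin_fact (leq_addr c n); rewrite addKn -addSn prednK //.
move=> <-; rewrite -[X in (_ * (X`! * _))%N]prednK // factS prednK // !natrM.
have nz k : (k`!)%:R != 0 :> rat by rewrite pnatr_eq0 -lt0n fact_gt0.
have nn : n%:R != 0 :> rat by rewrite pnatr_eq0 -lt0n.
have bn : 'C(n + c, n)%:R != 0 :> rat by rewrite pnatr_eq0 -lt0n bin_gt0 leq_addr.
by field; rewrite bn nn !nz.
Qed.

Lemma size_others r n (N : {set {ffun 'I_r -> 'I_n}}) f :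
  f \in N -> size (others N f) = #|N|.-1.
Proof. by move=> fN; rewrite size_map -cardE [in RHS](cardsD1 f) fN. Qed.

Lemma hit_self r n (f : {ffun 'I_r -> 'I_n}) (S : {set 'I_r}) :
  S != set0 -> f \in hit f S.
Proof.
by case/set0Pn=> i iS; rewrite inE; apply/exists_inP; exists i.
Qed.

Lemma prob_between r n N (f : {ffun 'I_r -> 'I_n}) (S : {set 'I_r}) :
  perfect N -> f \in N -> S != set0 ->
  (\sum_(s <- orderings r n)
     (between (others N f) (edge f) (others (hit f S) f) s)%:R)
    / (size (orderings r n))%:R =
  n%:R^-1 / 'C(#|hit f S| + n.-1, n)%:R :> rat.
Proof.
move=> pN fN S0; have [i iS] := set0Pn S S0.
have n_gt0 : (0 < n)%N by apply: leq_ltn_trans (ltn_ord (f i)).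
have hit_gt0 : (0 < #|hit f S|)%N by apply/card_gt0P; exists f; apply: hit_self.
pose E := enum (transversals r n).
have UE : uniq E by apply: enum_uniq.
(* Distinct members of a perfect set agree in no part, so [f] is the only member of [N] in
   [hit f S]. *)
have Uall : uniq (others N f ++ edge f :: others (hit f S) f).
  rewrite -map_cons -map_cat map_inj_uniq; last exact: edge_inj.
  rewrite cat_uniq /= !enum_uniq mem_enum !inE eqxx /=.
  rewrite mem_enum !inE eqxx /= andbT; apply/hasPn => g.
  rewrite !mem_enum !inE => /andP[gf /exists_inP[k kS /eqP gk]].
  apply/negP => /andP[_ gN]; case/eqP: gf.
  exact: perfect_inj pN gN fN gk.
have sub : {subset others N f ++ edge f :: others (hit f S) f <= E}.
  move=> e; rewrite -map_cons -map_cat => /mapP[g _ ->].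
  by rewrite mem_enum mem_transversals.
have := count_between UE Uall sub.
rewrite !size_others ?hit_self // (card_perfect_set i pN).
rewrite -(size_permutations UE) -/(orderings r n) => H.
rewrite -natr_sum -big_mkcond /= sum1_count.
have -> : (#|hit f S| + n.-1 = n + #|hit f S|.-1)%N by lia.
rewrite -ratio_binomial //.
have sz0 : (size (orderings r n))%:R != 0 :> rat.
  by rewrite pnatr_eq0 -lt0n size_permutations // fact_gt0.
have f0 : ((n.-1 + #|hit f S|.-1).+1`!)%:R != 0 :> rat.
  by rewrite pnatr_eq0 -lt0n fact_gt0.
apply/eqP; rewrite eqr_div // -!natrM H; apply/eqP; congr (_%:R).
Qed.

(** At most one [f] contributes, so the sum over [f] is the indicator of a disjunction;
    inclusion-exclusion over the vertices of that [f] gives the inner sum. *)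
Lemma edges_sub_G_omega_sum r n s (N : {set {ffun 'I_r -> 'I_n}})
  (i0 : 'I_r) (j0 : 'I_n) :
  s \in orderings r n -> perfect N ->
  (edge @: N \subset G_omega s)%:R =
  \sum_(f in N) \sum_(S : {set 'I_r} | S != set0) (-1) ^+ #|S|.-1 *
     (between (others N f) (edge f) (others (hit f S) f) s)%:R :> rat.
Proof.
move=> sO pN; rewrite (edges_sub_G_omega i0 j0 sO pN).
under eq_bigr => f _.
  under eq_bigr => S S0 do rewrite (between_hit s N f S0).
  rewrite -inclusion_exclusion_exists; over.
case: exists_inP => [[f fN bf]|nb] /=.
  rewrite (bigD1 f) //= bf big1 ?addr0 // => g /andP[gN].
  apply: contraNeq; rewrite pnatr_eq0 eqb0 negbK => /existsP[i bi].
  by have /existsP[j bj] := bf; rewrite (between_last_unique gN fN bi bj).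
by rewrite big1 // => f fN; case: (boolP [exists i, _]) => // bf; case: nb; exists f.
Qed.

Theorem theorem2 (r n : nat) (hr : (2 <= r)%N) (hn : (1 <= n)%N) :
  expected_matchings r n =
  ((n`! ^ r.-1)%N)%:R *
    \sum_(1 <= i < r.+1)
      (-1) ^+ i.-1 * ('C(r, i))%:R
        / ('C(n ^ r - (n.-1) ^ i * n ^ (r - i) + n.-1, n))%:R :> rat.
Proof.
have i0 : 'I_r by apply: Ordinal (ltnW hr).
have j0 : 'I_n by apply: Ordinal hn.
rewrite /expected_matchings big_seq.
(* Linearity of expectation: once the indicators are expanded, the sum over orderings can be moved
   inside. *)
under eq_bigr => s sO.
  rewrite num_matchingsE ?G_omega_sub // natr_sum.
  under eq_bigr => N pN do rewrite (edges_sub_G_omega_sum i0 j0 sO pN).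
  over.
rewrite -big_seq exchange_big /= mulr_suml.
(* The prefactor becomes a sum of ones over perfect sets, so that a single [N] remains to be
   treated. *)
rewrite -(card_perfect n i0) -sum1_card natr_sum mulr_suml.
apply: eq_big => [N|N pN]; first by rewrite inE.
rewrite mul1r exchange_big /= mulr_suml.
pose w k : rat := (-1) ^+ k.-1 / 'C(n ^ r - n.-1 ^ k * n ^ (r - k) + n.-1, n)%:R.
(* Every [f] in [N] contributes the same amount, since the size of [hit f S] depends on [#|S|]
   only. *)
rewrite (eq_bigr (fun=> n%:R^-1 * \sum_(S : {set 'I_r} | S != set0) w #|S|)).
  rewrite big_const iter_addr_0 (card_perfect_set i0 pN) -mulrnAl -mulr_natl.
  rewrite divff ?mul1r ?pnatr_eq0 -?lt0n // sum_card_nonempty card_ord.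
  by apply: eq_bigr => i _; rewrite /w mulrA [_%:R * _]mulrC.
move=> f fN; rewrite exchange_big /= mulr_suml mulr_sumr; apply: eq_bigr => S S0.
by rewrite -mulr_sumr -mulrA prob_between // card_hit mulrCA.
Qed.
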